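(* Let $n\ge 2$ and consider a space-like translator $\Gamma:\Omega\to\mathbb{H}^n\times_{-1}\mathbb{R}$, $\Gamma(p)=(p,u(p))$ for all $p\in\Omega$, where $\Omega\subset\mathbb{H}^n$ is open and connected and $u\in C^2(\Omega)$. Then $\Gamma$ is foliated by horospheres if, and only if, there exists $f\in C^2(I)$, $I\subseteq\mathbb{R}$ an interval with $\Omega=\rho^{-1}(I)$, such that $u=f\circ\rho$ and $f$ is one of the following: (1) $f_1:\mathbb{R}\to\mathbb{R}$, $f_1(s)=\frac{s}{n-1}+f_0$, $f_0\in\mathbb{R}$; (2) $n=2$, $f_3:\mathbb{R}\to\mathbb{R}$, $f_3(s)=\int P_2^{-1}(s)\,ds+f_0$, $f_0\in\mathbb{R}$; (3) $n>2$, $f_6:\mathbb{R}\to\mathbb{R}$, $f_6(s)=\int Q_2^{-1}(s)\,ds+f_0$, $f_0\in\mathbb{R}$; (4) $n>2$, $f_7:\mathbb{R}\to\mathbb{R}$, $f_7(s)=\int Q_3^{-1}(s)\,ds+f_0$, $f_0\in\mathbb{R}$.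
   Context: $\mathbb{H}^n=\{(x_1,\dots,x_n)\in\mathbb{R}^n : x_1>0\}$ is hyperbolic space with metric $g_{\mathbb{H}^n}=x_1^{-2}\langle\cdot,\cdot\rangle$, $\langle\cdot,\cdot\rangle$ Euclidean. $\mathbb{H}^n\times_{-1}\mathbb{R}$ is $\mathbb{H}^n\times\mathbb{R}$ with the Lorentzian metric $g_{\mathbb{H}^n}-dt^2$. For $u\in C^2(\Omega)$, let $\nabla u$, $|\nabla u|$, $\mathrm{div}$ be taken with respect to $g_{\mathbb{H}^n}$. The graph map $\Gamma(p)=(p,u(p))$ is assumed non-degenerate, with $\varepsilon=\mathrm{sign}(|\nabla u|^2-1)=\pm1$ constant on $\Omega$; it is space-like if $|\nabla u|<1$ ($\varepsilon=-1$). $\Gamma$ is a translator if its mean curvature vector equals $\partial_t^\perp$, the normal projection of $\partial_t$; equivalently $$\mathrm{div}\left(\frac{\nabla u}{\sqrt{\varepsilon(|\nabla u|^2-1)}}\right)=\frac{1}{\sqrt{\varepsilon(|\nabla u|^2-1)}}.$$ Horospheres here are the sets $\{x_1=\text{const}\}$, i.e. the level sets of the projection $\rho:\mathbb{H}^n\to\mathbb{R}$, $\rho(x_1,\dots,x_n)=\ln x_1$. $\Gamma$ is foliated by horospheres if $\Omega$ is foliated by such level sets and $u$ is constant on each of them (i.e. $u$ depends only on $x_1$). $P_2:(-1,1)\to\mathbb{R}$ is the increasing bijection $$P_2(x)=-\tfrac14\ln|1-x|+\tfrac12\cdot\tfrac{1}{1-x}+\tfrac14\ln|1+x|.$$ For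 $m=n-1>1$ put $$\mathbf{Q}(x)=\tfrac{1}{2m-2}\ln|1-x|+\tfrac{1}{2m+2}\ln|1+x|-\tfrac{m}{m^2-1}\ln|1-mx|.$$ $Q_2=\mathbf{Q}|_{(-1,1/m)}$ is an increasing bijection onto $\mathbb{R}$, and $Q_3=\mathbf{Q}|_{(1/m,1)}$ is a decreasing bijection onto $\mathbb{R}$.
   Formalization: The formal theorem takes ρ = −ln x_1 instead of ln x_1 (the listed f_i solve the translator equation only with this sign) and, in cases (2)–(4), allows a shift f(s) = f_i(s + s_0) with s_0 real, since translates of the profiles are also solutions. *)

(* Defs.v *)
From HB Require Import structures.
From mathcomp Require Import all_boot all_order all_algebra.
From mathcomp Require Import all_classical all_reals all_analysis.

Set Implicit Arguments.
Unset Strict Implicit.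
Unset Printing Implicit Defensive.

Import Order.TTheory GRing.Theory Num.Theory.
Import numFieldNormedType.Exports.

Local Open Scope classical_set_scope.
Local Open Scope ring_scope.

(* The hyperbolic space of dimension n >= 2 is modelled on R^n with n = m.+1,
   so that m = n - 1 >= 1; the coordinate x_1 is [x 0 ord0]. *)

Definition halfspace (R : realType) (m : nat) : set 'rV[R]_m.+1 :=
  [set x | 0 < x 0 ord0].

Definition partial (R : realType) (m : nat) (i : 'I_m.+1)
    (u : 'rV[R]_m.+1 -> R) : 'rV[R]_m.+1 -> R :=
  fun x => 'D_(delta_mx 0 i) u x.

(* Used for open Omega only, so that two-sided derivatives and full
   neighbourhoods are the right notion; values outside Omega are irrelevant. *)
Definition C2_on (R : realType) (m : nat) (Omega : set 'rV[R]_m.+1)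
    (u : 'rV[R]_m.+1 -> R) : Prop :=
  forall x, Omega x -> {for x, continuous u} /\
    forall i j : 'I_m.+1,
      [/\ derivable u x (delta_mx 0 i),
          {for x, continuous (partial i u)},
          derivable (partial i u) x (delta_mx 0 j) &
          {for x, continuous (partial j (partial i u))}].

(* One variable. The interval I is open whenever the preimage of I under [rho]
   is open, hence again two-sided derivatives. *)
Definition C2_itv (R : realType) (I : set R) (f : R -> R) : Prop :=
  forall s, I s ->
    [/\ derivable f s 1, derivable (derive1 f) s 1 &
        {for s, continuous (derive1 (derive1 f))}].

(* Riemannian calculus in a single chart: [g x] is the Gram matrix of the
   metric at x in the coordinate frame, vector fields are given by their
   components in that frame. *)
Definition grad (R : realType) (m : nat) (g : 'rV[R]_m.+1 -> 'M[R]_m.+1)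
    (u : 'rV[R]_m.+1 -> R) : 'rV[R]_m.+1 -> 'rV[R]_m.+1 :=
  fun x => (\row_i partial i u x) *m invmx (g x).

Definition riem_norm (R : realType) (m : nat) (g : 'rV[R]_m.+1 -> 'M[R]_m.+1)
    (X : 'rV[R]_m.+1 -> 'rV[R]_m.+1) : 'rV[R]_m.+1 -> R :=
  fun x => Num.sqrt ((X x *m g x *m (X x)^T) 0 0).

Definition divergence (R : realType) (m : nat) (g : 'rV[R]_m.+1 -> 'M[R]_m.+1)
    (X : 'rV[R]_m.+1 -> 'rV[R]_m.+1) : 'rV[R]_m.+1 -> R :=
  fun x => (Num.sqrt (\det (g x)))^-1 *
    \sum_i partial i (fun y => Num.sqrt (\det (g y)) * X y 0 i) x.

Definition hyp_metric (R : realType) (m : nat) (x : 'rV[R]_m.+1) :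
    'M[R]_m.+1 := (x 0 ord0 ^- 2)%:M.

Definition spacelike (R : realType) (m : nat) (Omega : set 'rV[R]_m.+1)
    (u : 'rV[R]_m.+1 -> R) : Prop :=
  forall x, Omega x -> riem_norm (@hyp_metric R m) (grad (@hyp_metric R m) u) x < 1.

(* eps is the constant sign of |grad u|^2 - 1. *)
Definition graph_weight (R : realType) (m : nat) (eps : R)
    (u : 'rV[R]_m.+1 -> R) : 'rV[R]_m.+1 -> R :=
  fun x => Num.sqrt
    (eps * (riem_norm (@hyp_metric R m) (grad (@hyp_metric R m) u) x ^+ 2 - 1)).

Definition translator (R : realType) (m : nat) (eps : R)
    (Omega : set 'rV[R]_m.+1) (u : 'rV[R]_m.+1 -> R) : Prop :=
  forall x, Omega x ->
    divergence (@hyp_metric R m)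
      (fun y => (graph_weight eps u y)^-1 *: grad (@hyp_metric R m) u y) x
    = (graph_weight eps u x)^-1.

(* The projection onto the leaf parameter. The horospheres determine it only up
   to an isometry of the real line, and the sign matters: div(grad(ln x_1)) is
   equal to -m, so for u = f(ln x_1) the translator equation reads
     f'' = (1 - f'^2) (1 + m f'),
   whereas the functions s/m, P2 and Q below integrate
     f'' = (1 - f'^2) (1 - m f'),
   which is the translator equation for u = f(- ln x_1). *)
Definition rho (R : realType) (m : nat) (x : 'rV[R]_m.+1) : R :=
  - ln (x 0 ord0).

Definition horosphere (R : realType) (m : nat) (c : R) : set 'rV[R]_m.+1 :=
  [set x | halfspace x /\ rho x = c].

Definition foliated_by_horospheres (R : realType) (m : nat)
    (Omega : set 'rV[R]_m.+1) (u : 'rV[R]_m.+1 -> R) : Prop :=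
  forall c : R, @horosphere R m c `&` Omega !=set0 ->
    @horosphere R m c `<=` Omega /\
    forall x y, @horosphere R m c x -> @horosphere R m c y -> u x = u y.

Definition P2 (R : realType) (x : R) : R :=
  - (1 / 4) * ln `|1 - x| + 1 / 2 * (1 / (1 - x)) + 1 / 4 * ln `|1 + x|.

Definition Q (R : realType) (m : nat) (x : R) : R :=
  1 / (2 * m%:R - 2) * ln `|1 - x| + 1 / (2 * m%:R + 2) * ln `|1 + x|
  - m%:R / (m%:R ^+ 2 - 1) * ln `|1 - m%:R * x|.

Definition P2_inv (R : realType) : R -> R := pinv [set x : R | -1 < x < 1] (@P2 R).

Definition Q2_inv (R : realType) (m : nat) : R -> R :=
  pinv [set x : R | -1 < x < m%:R^-1] (@Q R m).

Definition Q3_inv (R : realType) (m : nat) : R -> R :=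
  pinv [set x : R | m%:R^-1 < x < 1] (@Q R m).

Definition integral_from0 (R : realType) (g : R -> R) (s : R) : R :=
  if 0 <= s then \int[@lebesgue_measure R]_(t in `[0, s]) g t
  else - \int[@lebesgue_measure R]_(t in `[s, 0]) g t.

Definition f1 (R : realType) (m : nat) (f0 s : R) : R := s / m%:R + f0.

Definition f3 (R : realType) (f0 s : R) : R :=
  integral_from0 (@P2_inv R) s + f0.

Definition f6 (R : realType) (m : nat) (f0 s : R) : R :=
  integral_from0 (@Q2_inv R m) s + f0.

Definition f7 (R : realType) (m : nat) (f0 s : R) : R :=
  integral_from0 (@Q3_inv R m) s + f0.

(* Main.v *)
(** A translator foliated by horospheres is u = f o rho, and its slope p = f'
    solves p' = (1 - p^2) (1 - m p) with |p| < 1. If p takes the equilibrium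
    value 1/m, then it is constant and f is affine. Otherwise p stays in one
    component of ]-1, 1[ minus {1/m}; there P2 (for m = 1), resp. Q (for m > 1),
    is a primitive of the reciprocal of the right-hand side, so its value at
    p(s) is s + s0 and f' is its inverse function shifted by s0. Since the
    right-hand side vanishes at least linearly at the ends of the component, the
    primitive is onto the line, and since it is bounded, the inverse is
    Lipschitz. *)

Require Import Defs.
From mathcomp Require Import all_boot all_order all_algebra.
From mathcomp Require Import all_classical all_reals all_analysis.
From mathcomp Require Import ring lra.

Import Order.TTheory GRing.Theory Num.Theory.
Import numFieldNormedType.Exports.

Local Open Scope classical_set_scope.
Local Open Scope ring_scope.

(** * Separable equations on the line *)

Section RealLine.
#[local] Set Implicit Arguments.
#[local] Unset Strict Implicit.
Context {R : realType}.
Implicit Types (I : set R) (f df g F phi : R -> R).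

(** * Mean value and intermediate value arguments on an interval *)

Lemma is_derive_continuous {f} {x df : R} :
  is_derive x 1 f df -> {for x, continuous f}.
Proof. by move=> [+ _] => /derivable1_diffP/differentiable_continuous. Qed.

Lemma interval_mem {I} {x y z : R} : is_interval I -> I x -> I y ->
  z \in `[x, y] -> I z.
Proof. by move=> itvI Ix Iy; rewrite in_itv/= => zxy; exact: itvI zxy. Qed.

Lemma interval_MVT I f df (x y : R) : is_interval I ->
  (forall s, I s -> is_derive s 1 f (df s)) -> I x -> I y -> x <= y ->
  exists2 c, I c & f y - f x = df c * (y - x).
Proof.
move=> itvI fdf Ix Iy xy.
have [| |c cxy ->] := @MVT_segment R f df x y xy.
- by move=> z /subset_itv_oo_cc zxy; apply: fdf; exact: interval_mem zxy.
- apply: continuous_in_subspaceT => z; rewrite inE/= => zxy.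
  exact: is_derive_continuous (fdf _ (interval_mem itvI Ix Iy zxy)).
- by exists c => //; exact: interval_mem cxy.
Qed.

Lemma is_derive_ge0_le I f df (x y : R) : is_interval I ->
  (forall s, I s -> is_derive s 1 f (df s)) ->
  (forall s, I s -> 0 <= df s) -> I x -> I y -> x <= y -> f x <= f y.
Proof.
move=> itvI fdf df0 Ix Iy xy.
have [c Ic /eqP] := interval_MVT itvI fdf Ix Iy xy.
by rewrite subr_eq => /eqP->; rewrite lerDr mulr_ge0 ?df0// subr_ge0.
Qed.

Lemma is_derive_eq0_cst I f (x y : R) : is_interval I ->
  (forall s, I s -> is_derive s 1 f 0) -> I x -> I y -> f x = f y.
Proof.
move=> itvI f0.
wlog xy : x y / x <= y.
  by move=> h Ix Iy; have [/h->//|/ltW/h->] := leP x y.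
move=> Ix Iy.
have [c _ /eqP] := interval_MVT itvI f0 Ix Iy xy.
by rewrite mul0r subr_eq0 => /eqP.
Qed.

(** The points x and y come in either order, so crossing a level upwards or downwards in time is
    treated alike. *)
Lemma interval_IVT I f (x y v : R) : is_interval I ->
  (forall s, I s -> {for s, continuous f}) -> I x -> I y ->
  f x <= v <= f y -> exists2 c, I c & f c = v.
Proof.
move=> itvI cf Ix Iy /andP[xv vy].
have cw a b : I a -> I b -> {within `[a, b], continuous f}.
  move=> Ia Ib; apply: continuous_in_subspaceT => z; rewrite inE/= => zab.
  exact: cf (interval_mem itvI Ia Ib zab).
have [xy|/ltW yx] := leP x y.
  have [|c cxy <-] := @IVT R f x y v xy (cw _ _ Ix Iy).
    by rewrite ge_min xv/= le_max vy orbT.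
  by exists c => //; exact: interval_mem cxy.
have [|c cxy <-] := @IVT R f y x v yx (cw _ _ Iy Ix).
  by rewrite ge_min xv orbT/= le_max vy.
by exists c => //; exact: interval_mem cxy.
Qed.

Lemma is_interval_oo (a b : R) : is_interval [set x | a < x < b].
Proof.
move=> x y /= /andP[ax _] /andP[_ yb] z /andP[xz zy].
by rewrite (lt_le_trans ax xz) (le_lt_trans zy yb).
Qed.

(** On ]-N, +oo[ both branches of [integral_from0 g] equal the integral from -N to x minus the
    integral from -N to 0. The fundamental theorem then applies at once, including at s = 0. *)
Lemma integral_from0_derive g : continuous g ->
  forall s : R, is_derive s 1 (integral_from0 g) (g s).
Proof.
move=> cg s.
pose mu := @lebesgue_measure R.
have ig a b : mu.-integrable `[a, b] (EFin \o g).
  apply: continuous_compact_integrable; first exact: segment_compact.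
  exact: continuous_subspaceT.
pose N : R := `|s| + 1.
have [sN Ns] : s < N /\ - N < s.
  by have := ler_norm s; have := ler_norm (- s); rewrite normrN /N; lra.
have N0 : 0 < N by rewrite /N ltr_wpDl.
pose H (x : R) : R := (\int[mu]_(t in `[(- N)%R, x]) g t)%R.
have [dH H'] : derivable H s 1 /\ derive1 H s = g s.
  exact: (@continuous_FTC1_closed _ g (- N) s N sN (ig _ _) Ns (cg s)).
have HE (x : R) : - N < x -> integral_from0 g x = H x - H 0.
  move=> Nx; rewrite /integral_from0; case: ifPn => [x0|].
    rewrite /H Rintegral_itvB ?bnd_simp//.
    - rewrite Rintegral_itv_obnd_cbnd//.
      apply: (integrableS _ _ _ (ig 0 x)) => //.
      exact: subset_itv_oc_cc.
    - by rewrite oppr_le0 ltW.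
  rewrite -ltNge => x0; rewrite -[RHS]opprB; congr (- _).
  rewrite /H Rintegral_itvB ?bnd_simp//.
  - rewrite Rintegral_itv_obnd_cbnd//.
    apply: (integrableS _ _ _ (ig x 0)) => //.
    exact: subset_itv_oc_cc.
  - exact: ltW.
  - exact: ltW.
have dHs : is_derive s 1 (fun x => H x - H 0) (g s).
  have dHs : is_derive s 1 H (g s) by split; [exact: dH|rewrite -derive1E].
  rewrite -[g s]subr0; exact: (@is_deriveB _ _ _ H (cst (H 0))).
apply: near_eq_is_derive dHs.
near=> x; rewrite HE//; near: x.
exact: lt_nbhsr.
Unshelve. all: by end_near. Qed.

(** * Derivation rules for functions given by pointwise formulas *)

Lemma is_deriveD_fun {f g} {x df dg : R} :
  is_derive x 1 f df -> is_derive x 1 g dg ->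
  is_derive x 1 (fun t => f t + g t) (df + dg).
Proof. exact: is_deriveD. Qed.

Lemma is_deriveN_fun {f} {x df : R} :
  is_derive x 1 f df -> is_derive x 1 (fun t => - f t) (- df).
Proof. exact: is_deriveN. Qed.

Lemma is_deriveM_fun {f g} {x df dg : R} :
  is_derive x 1 f df -> is_derive x 1 g dg ->
  is_derive x 1 (fun t => f t * g t) (f x * dg + g x * df).
Proof. exact: is_deriveM. Qed.

Lemma is_deriveZ_fun (c : R) {f} {x df : R} :
  is_derive x 1 f df -> is_derive x 1 (fun t => c * f t) (c * df).
Proof. exact: is_deriveZ. Qed.

Lemma is_derive_comp_fun {f g} {x df dg : R} :
  is_derive (g x) 1 f df -> is_derive x 1 g dg ->
  is_derive x 1 (fun t => f (g t)) (df * dg).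
Proof. exact: is_derive1_comp. Qed.

Lemma is_derive_affine (c d x : R) : is_derive x 1 (fun t => d + c * t) c.
Proof.
have := is_deriveD_fun (is_derive_cst d x 1)
  (is_deriveM_fun (is_derive_cst c x 1) (is_derive_id x 1)).
by rewrite mulr1 mulr0 addr0 add0r.
Qed.

(** Half the logarithm of the square has no absolute value in it, so one chain rule covers both
    signs of [d + c * x]. The affine argument serves 1 - x, 1 + x and 1 - m x. *)
Lemma is_derive_ln_norm (c d x : R) : d + c * x != 0 ->
  is_derive x 1 (fun t => ln `|d + c * t|) (c / (d + c * x)).
Proof.
move=> h.
(* both sides vanish at a zero of [d + c * t], since [ln 0 = 0] *)
have -> : (fun t => ln `|d + c * t|) =
    (fun t => 2^-1 * ln ((d + c * t) * (d + c * t))).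
  apply/funext => t; have [->|h0] := eqVneq (d + c * t) 0.
    by rewrite mulr0 normr0 ln0// mulr0.
  rewrite -expr2 -[X in _ = _ * ln X]real_normK ?num_real// lnXn ?normr_gt0//.
  by field.
have p0 : 0 < (d + c * x) * (d + c * x) by rewrite -expr2 exprn_even_gt0.
have D := is_derive_affine c d x.
apply: is_derive_eq.
  apply: is_deriveM_fun.
  exact: (@is_derive_comp_fun _ (fun t => (d + c * t) * (d + c * t)) _ _ _
    (is_derive1_ln p0) (is_deriveM_fun D D)).
by rewrite /=; field.
Qed.

(** * Primitives of 1 / phi are unbounded where phi vanishes at least linearly *)

Section BlowUp.
Variables (a b K : R) (F phi : R -> R).
Hypothesis ab : a < b.
Hypothesis F' : forall x, a < x < b -> is_derive x 1 F (phi x)^-1.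

(* [F + ln (b - x) / K] is nondecreasing. *)
Lemma blowup_unbounded :
  (forall x, a < x < b -> 0 < phi x <= K * (b - x)) ->
  forall M, exists2 x, a < x < b & M <= F x.
Proof.
move=> phiK M.
pose x0 := (a + b) / 2.
have x0ab : a < x0 < b by rewrite !midf_lt.
have [ax0 x0b] := andP x0ab.
have K0 : 0 < K.
  have /andP[h1 h2] := phiK _ x0ab.
  by have := lt_le_trans h1 h2; rewrite pmulr_lgt0// subr_gt0.
(* From x0 to x the term [ln (b - x) / K] drops by exactly N, so F gains at least N. The bound N >=
   0 gives x0 <= x, and N >= M - F x0 gives M <= F x. *)
pose N := Num.max 0 (M - F x0).
pose x := b - (b - x0) * expR (- (K * N)).
have e1 : expR (- (K * N)) <= 1.
  by rewrite -expR0 ler_expR oppr_le0 mulr_ge0// ?le_max ?lexx// ltW.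
have e0 := expR_gt0 (- (K * N)).
have bx0 : 0 < b - x0 by rewrite subr_gt0.
have x0x : x0 <= x.
  by rewrite /x lerBrDl -lerBrDr ler_piMr// ltW.
have xab : a < x < b.
  rewrite (lt_le_trans ax0 x0x)/= /x ltrBlDr ltrDl mulr_gt0//.
exists x => //.
have dG z : a < z < b ->
    is_derive z 1 (fun t => F t + K^-1 * ln `|b + (- 1) * t|)
    ((phi z)^-1 - (K * (b - z))^-1).
  move=> zab; have bz : b - z != 0.
    by rewrite subr_eq0 gt_eqF//; case/andP: zab.
  have Dz := F' zab.
  apply: is_derive_eq.
    apply: is_deriveD_fun; apply: is_deriveM_fun; apply: is_derive_ln_norm.
    by rewrite mulN1r.
  rewrite /=; field.
  by rewrite bz gt_eqF//; case/andP: (phiK _ zab) => /gt_eqF->.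
have dG0 z : a < z < b -> 0 <= (phi z)^-1 - (K * (b - z))^-1.
  move=> zab; have /andP[h1 h2] := phiK _ zab.
  by rewrite subr_ge0 lef_pV2 ?posrE// (lt_le_trans h1 h2).
have := @is_derive_ge0_le _ _ _ x0 x (is_interval_oo (a := a) (b := b)) dG
  dG0 x0ab xab x0x.
rewrite !mulN1r !gtr0_norm; last 2 first.
- by rewrite subr_gt0; case/andP: xab.
- by [].
have -> : b - x = (b - x0) * expR (- (K * N)) by rewrite /x; ring.
rewrite lnM ?posrE// expRK mulrDr => le.
have : F x0 + N <= F x.
  have e : K^-1 * - (K * N) = - N by rewrite mulrN mulKf // gt_eqF.
  move: le; rewrite e; lra.
apply: le_trans; rewrite -lerBlDl; by rewrite le_max lexx orbT.
Qed.
End BlowUp.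

(** The bound at b makes F unbounded above. The reflection [- F (- x)] turns the bound at a into
    unboundedness below, and the intermediate value theorem fills the gap. *)
Lemma blowup_surj (a b K : R) F phi : a < b ->
  (forall x, a < x < b -> is_derive x 1 F (phi x)^-1) ->
  (forall x, a < x < b ->
    [/\ 0 < phi x, phi x <= K * (x - a) & phi x <= K * (b - x)]) ->
  forall y, exists2 x, a < x < b & F x = y.
Proof.
move=> ab F' phiK y.
have [x2 x2ab yF] : exists2 x, a < x < b & y <= F x.
  apply: (blowup_unbounded ab F') => x /phiK[-> _ h]; exact: h.
have [x1 x1ab Fy] : exists2 x, a < x < b & F x <= y.
  have opp x : - b < x < - a -> a < - x < b.
    by rewrite andbC ltrNr [- x < b]ltrNl.
  have [|||x xab] := @blowup_unbounded (- b) (- a) K (fun x => - F (- x))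
    (fun x => phi (- x)) _ _ _ (- y).
  - by rewrite ltrN2.
  - move=> x /opp xab; have D := F' _ xab.
    by apply: is_derive_eq; rewrite mulrN1 opprK.
  - move=> x /opp /phiK[-> h _] /=; by rewrite addrC.
  - by rewrite lerN2 => h; exists (- x) => //; exact: opp.
have cF s (sab : a < s < b) := is_derive_continuous (F' _ sab).
have yF12 : F x1 <= y <= F x2 by rewrite Fy.
have [c cab <-] :=
  interval_IVT (is_interval_oo (a := a) (b := b)) cF x1ab x2ab yF12.
by exists c.
Qed.

(** * Inverting the primitive and solving the separable equation *)

Section PInv.
Variables (a b L : R) (F phi : R -> R).
Hypothesis F' : forall x, a < x < b -> is_derive x 1 F (phi x)^-1.
Hypothesis phi0 : forall x, a < x < b -> 0 < `|phi x| <= L.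
Hypothesis surjF : forall y, exists2 x, a < x < b & F x = y.
Let J : set R := [set x | a < x < b].

(** Mean value theorem with |F'| = 1 / |phi| >= 1 / L. Whatever the sign of phi, this yields both
    the injectivity of F and the Lipschitz bound for its inverse. *)
Lemma expanding (x y : R) : J x -> J y -> `|y - x| <= L * `|F y - F x|.
Proof.
wlog xy : x y / x <= y.
  move=> h Jx Jy; have [/h->//|/ltW yx] := leP x y.
  by rewrite distrC [X in L * X]distrC; exact: h.
move=> Jx Jy.
have [c /phi0/andP[c0 cL] ->] :=
  interval_MVT (is_interval_oo (a := a) (b := b)) F' Jx Jy xy.
rewrite normrM mulrA ler_peMl//.
by rewrite normfV ler_pdivlMr// mul1r.
Qed.

Lemma pinv_expanding_mem (s : R) : J (pinv J F s).
Proof.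
have FJ : set_surj J setT F by move=> y _; have [x ? <-] := surjF y; exists x.
by apply: (surjpinv_image_sub FJ); exists s.
Qed.

Lemma pinv_expandingK (s : R) : F (pinv J F s) = s.
Proof.
apply: pinvK; rewrite inE; have [x xab <-] := surjF s; by exists x.
Qed.

Lemma pinv_expandingKV (x : R) : J x -> pinv J F (F x) = x.
Proof.
move=> Jx; have := expanding Jx (pinv_expanding_mem (F x)).
by rewrite pinv_expandingK subrr normr0 mulr0 normr_le0 subr_eq0 => /eqP.
Qed.

Lemma pinv_expanding_continuous : continuous (pinv J F).
Proof.
move=> s.
have L0 : 0 < L.
  by have /phi0/andP[h1 h2] := pinv_expanding_mem s; exact: lt_le_trans h2.
apply/cvgrPdist_lt => /= e e0; near=> t.
have := expanding (pinv_expanding_mem t) (pinv_expanding_mem s).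
rewrite !pinv_expandingK => /le_lt_trans; apply.
rewrite -ltr_pdivlMl// mulrC; near: t.
by apply: cvgr_dist_lt; [exact: cvg_id|rewrite divr_gt0].
Unshelve. all: by end_near. Qed.

(** By the chain rule [F (p s)] has derivative [phi (p s) / phi (p s) = 1], so [F (p s) - s] is a
    constant s0 and p is the inverse of F shifted by s0. A second comparison of derivatives then
    determines f up to f0. *)
Lemma separable_ODE_integral I f (p : R -> R) : is_interval I ->
  (forall s, I s -> is_derive s 1 f (p s)) ->
  (forall s, I s -> is_derive s 1 p (phi (p s))) ->
  (forall s, I s -> a < p s < b) ->
  exists s0 f0 : R, forall s, I s ->
    f s = integral_from0 (pinv J F) (s + s0) + f0.
Proof.
move=> itvI f' p' pJ.
have [[s1 Is1]|I0] := pselect (exists s, I s); last first.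
  by exists 0, 0 => s Is; exfalso; apply: I0; exists s.
have shift_derive (s0 s : R) : is_derive s 1 (fun t => t + s0) 1.
  have := is_deriveD_fun (is_derive_id s 1) (is_derive_cst s0 s 1).
  by rewrite addr0.
pose s0 := F (p s1) - s1.
have Fp s : I s -> F (p s) = s + s0.
  move=> Is; suff : F (p s) - s = s0 by move=> <-; rewrite addrC subrK.
  apply: (is_derive_eq0_cst (f := fun t => F (p t) - t) itvI _ Is Is1) => t It.
  have /andP[phit _] := phi0 (pJ _ It).
  apply: is_derive_eq.
    have D := is_derive_comp_fun (F' (pJ _ It)) (p' _ It).
    exact: (is_deriveD_fun D (is_deriveN_fun (is_derive_id t 1))).
  by rewrite mulVf ?subrr// -normr_gt0.
have pE s : I s -> p s = pinv J F (s + s0).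
  by move=> Is; rewrite -Fp// pinv_expandingKV//; exact: pJ.
pose h s := f s - integral_from0 (pinv J F) (s + s0).
exists s0, (h s1) => s Is.
suff <- : h s = h s1 by rewrite addrC subrK.
apply: (is_derive_eq0_cst itvI _ Is Is1) => t It.
apply: is_derive_eq.
  have D := integral_from0_derive pinv_expanding_continuous (t + s0).
  have E := is_derive_comp_fun (g := fun r => r + s0) D (shift_derive s0 t).
  exact: (is_deriveD_fun (f' _ It) (is_deriveN_fun E)).
by rewrite mulr1 -pE// subrr.
Qed.

End PInv.

(** * The slope equation *)

Definition slope_ODE (k x : R) : R := (1 - x ^+ 2) * (1 - k * x).

(* With q = p - 1/k, q^2 is nonincreasing and q^2 exp(2 k s) is nondecreasing,
   so a zero of q propagates in both directions. *)
Lemma slope_equilibrium I (p : R -> R) (k s1 : R) : 0 < k -> is_interval I ->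
  (forall s, I s -> is_derive s 1 p (slope_ODE k (p s))) ->
  (forall s, I s -> -1 < p s < 1) ->
  I s1 -> p s1 = k^-1 -> forall s, I s -> p s = k^-1.
Proof.
move=> k0 itvI p' p1 Is1 ps1 s Is.
pose q t := p t - k^-1.
have q' t : I t -> is_derive t 1 q (slope_ODE k (p t)).
  move=> It; have := is_deriveD_fun (p' _ It) (is_derive_cst (- k^-1) t 1).
  by rewrite addr0.
have phiE t : slope_ODE k (p t) = - k * (1 - p t ^+ 2) * q t.
  by rewrite /slope_ODE /q; field; rewrite gt_eqF.
have w0 t : I t -> 0 <= 1 - p t ^+ 2 <= 1.
  move=> /p1/andP[? ?]; rewrite lerBlDr lerDl sqr_ge0 andbT; nra.
have q1 : q s1 = 0 by rewrite /q ps1 subrr.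
suff : q s = 0 by move/eqP; rewrite subr_eq0 => /eqP.
(* To the right of s1, q^2 starts at 0 and cannot grow; to the left, the nondecreasing weighted
   square ends at 0 and cannot be positive before. *)
have [s1s|/ltW ss1] := leP s1 s.
  have N' t : I t -> is_derive t 1 (fun t => - (q t * q t))
      (- (q t * slope_ODE k (p t) + q t * slope_ODE k (p t))).
    by move=> /q' D; exact: is_deriveN_fun (is_deriveM_fun D D).
  have := is_derive_ge0_le itvI N' _ Is1 Is s1s.
  rewrite q1 mulr0 oppr0 oppr_ge0 => h.
  have /h : forall t, I t ->
      0 <= - (q t * slope_ODE k (p t) + q t * slope_ODE k (p t)).
    move=> t /w0/andP[wt _]; rewrite phiE.
    have -> : - (q t * (- k * (1 - p t ^+ 2) * q t) +
        q t * (- k * (1 - p t ^+ 2) * q t)) =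
      2 * k * (1 - p t ^+ 2) * (q t ^+ 2) by ring.
    by rewrite mulr_ge0 ?sqr_ge0// mulr_ge0// ltW// mulr_gt0.
  by rewrite -expr2 => q2; apply/eqP; rewrite -sqrf_eq0 eq_le q2 sqr_ge0.
pose e t := expR (0 + 2 * k * t).
have e' (t : R) : is_derive t 1 e (e t * (2 * k)).
  exact: is_derive_comp_fun (is_derive_expR _) (is_derive_affine _ _ _).
have M' (t : R) : I t -> is_derive t 1 (fun t => q t * q t * e t) 
   (q t * q t * (e t * (2 * k)) + e t *
   (q t * slope_ODE k (p t) + q t * slope_ODE k (p t))).
  by move=> /q' D; exact: is_deriveM_fun (is_deriveM_fun D D) (e' t).
have e0 t : 0 < e t by exact: expR_gt0.
have := is_derive_ge0_le itvI M' _ Is Is1 ss1.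
rewrite q1 !mul0r pmulr_lle0// => h.
have /h : forall t, I t -> 0 <= q t * q t * (e t * (2 * k)) + e t *
   (q t * slope_ODE k (p t) + q t * slope_ODE k (p t)).
  move=> t It; rewrite phiE.
  (* The weight contributes 2 k and the equation - 2 k (1 - p^2), which leaves 2 k p^2. *)
  have -> : q t * q t * (e t * (2 * k)) + e t *
      (q t * (- k * (1 - p t ^+ 2) * q t) + q t * (- k * (1 - p t ^+ 2) * q t))
    = 2 * k * e t * (q t * p t) ^+ 2 by ring.
  by rewrite mulr_ge0 ?sqr_ge0// mulr_ge0// ltW// mulr_gt0.
by rewrite -expr2 => q2; apply/eqP; rewrite -sqrf_eq0 eq_le q2 sqr_ge0.
Qed.

(** Partial fractions with a double pole at 1: 1 / ((1 - x)^2 (1 + x)) is the sum of 1/4 / (1 - x),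
    1/2 / (1 - x)^2 and 1/4 / (1 + x). *)
Lemma is_derive_P2 (x : R) : -1 < x < 1 ->
  is_derive x 1 (@P2 R) (slope_ODE 1 x)^-1.
Proof.
move=> /andP[x0 x1].
have -> : @P2 R = (fun t => - (1 / 4) * ln `|1 + (- 1) * t|
    + 1 / 2 * (1 * (1 + (- 1) * t)^-1) + 1 / 4 * ln `|1 + 1 * t|).
  by apply/funext => t; rewrite /P2 !mulN1r !mul1r.
have h1 : 1 + (- 1) * x != 0 by rewrite gt_eqF//; lra.
have h2 : 1 + 1 * x != 0 by rewrite gt_eqF//; lra.
have D1 := is_derive_ln_norm h1.
have D2 := is_derive_ln_norm h2.
have D3 := @is_deriveV _ (fun t => 1 + (- 1) * t) _ _ _ h1
  (is_derive_affine (-1) 1 x).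
have := is_deriveD_fun (is_deriveD_fun
    (is_deriveZ_fun (- (1 / 4)) D1)
    (is_deriveZ_fun (1 / 2) (is_deriveZ_fun 1 D3)))
  (is_deriveZ_fun (1 / 4) D2).
congr (is_derive _ _ _ _); rewrite /slope_ODE /GRing.scale/=.
have h1' : 1 - x != 0 by rewrite gt_eqF//; lra.
have h2' : 1 + x != 0 by rewrite gt_eqF//; lra.
have -> : 1 - x ^+ 2 = (1 - x) * (1 + x) by ring.
rewrite !mulN1r !mul1r; field. by rewrite h1' h2'.
Qed.

(** Partial fractions again; since m > 1, the poles 1, -1 and 1/m are distinct and simple. *)
Lemma is_derive_Q (m : nat) (x : R) : (1 < m)%N ->
  -1 < x < 1 -> x != m%:R^-1 ->
  is_derive x 1 (@Q R m) (slope_ODE m%:R x)^-1.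
Proof.
rewrite -(@ltr1n R) => m1 /andP[x0 x1] xm.
have -> : @Q R m = (fun t =>
    1 / (2 * m%:R - 2) * ln `|1 + (- 1) * t|
    + 1 / (2 * m%:R + 2) * ln `|1 + 1 * t|
    + - (m%:R / (m%:R ^+ 2 - 1)) * ln `|1 + (- m%:R) * t|).
  by apply/funext => t; rewrite /Q mulN1r !mul1r !mulNr.
have m0 : m%:R != 0 :> R by rewrite gt_eqF// (lt_trans _ m1).
have h1 : 1 + (- 1) * x != 0 by rewrite gt_eqF//; lra.
have h2 : 1 + 1 * x != 0 by rewrite gt_eqF//; lra.
have h3' : 1 - m%:R * x != 0.
  apply: contra xm; rewrite subr_eq0 => /eqP mx.
  by apply/eqP; apply: (mulfI m0); rewrite -mx mulfV.
have h3 : 1 + (- m%:R) * x != 0 by rewrite mulNr.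
have := is_deriveD_fun (is_deriveD_fun
    (is_deriveZ_fun (1 / (2 * m%:R - 2)) (is_derive_ln_norm h1))
    (is_deriveZ_fun (1 / (2 * m%:R + 2)) (is_derive_ln_norm h2)))
  (is_deriveZ_fun (- (m%:R / (m%:R ^+ 2 - 1))) (is_derive_ln_norm h3)).
congr (is_derive _ _ _ _); rewrite /slope_ODE.
have h1' : 1 - x != 0 by rewrite gt_eqF//; lra.
have h2' : 1 + x != 0 by rewrite gt_eqF//; lra.
have h4 : m%:R - 1 != 0 :> R by rewrite gt_eqF//; lra.
have h5 : m%:R + 1 != 0 :> R by rewrite gt_eqF//; lra.
have -> : 1 - x ^+ 2 = (1 - x) * (1 + x) by ring.
have -> : m%:R ^+ 2 - 1 = (m%:R - 1) * (m%:R + 1) :> R by ring.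
have -> : 2 * m%:R - 2 = 2 * (m%:R - 1) :> R by ring.
have -> : 2 * m%:R + 2 = 2 * (m%:R + 1) :> R by ring.
rewrite !mulNr !mul1r; field. by rewrite h1' h2' h3' h4 h5.
Qed.

(** The field is positive between the zeros -1 and 1/k, and each factor 1 - x, 1 + x, 1 - k x is at
    most 2 or 1 + k there, whence the constants. With k = 1 this is the case of [P2], with k > 1
    that of [Q2_inv]. *)
Lemma slope_ODE_below (k : R) F I f (p : R -> R) : 1 <= k ->
  (forall x, -1 < x < k^-1 -> is_derive x 1 F (slope_ODE k x)^-1) ->
  is_interval I -> (forall s, I s -> is_derive s 1 f (p s)) ->
  (forall s, I s -> is_derive s 1 p (slope_ODE k (p s))) ->
  (forall s, I s -> -1 < p s < k^-1) ->
  exists s0 f0 : R, forall s, I s ->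
    f s = integral_from0 (pinv [set x | -1 < x < k^-1] F) (s + s0) + f0.
Proof.
move=> k1 F'; have k0 : 0 < k by rewrite (lt_le_trans _ k1).
have vk1 : k^-1 <= 1 by rewrite invf_le1.
have phiE x : slope_ODE k x = (1 - x ^+ 2) * k * (k^-1 - x).
  by rewrite /slope_ODE; field; rewrite gt_eqF.
have bnd x : -1 < x < k^-1 -> [/\ 0 < slope_ODE k x,
    slope_ODE k x <= 2 * (1 + k) * (x - -1) &
    slope_ODE k x <= 2 * (1 + k) * (k^-1 - x)].
  move=> /andP[x0 xk]; have kx : k * x < 1.
    by rewrite -ltr_pdivlMl// mulr1.
  split.
  - rewrite phiE !mulr_gt0 ?subr_gt0//; nra.
  - rewrite /slope_ODE; suff : (1 - x) * (1 - k * x) <= 2 * (1 + k) by nra.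
    nra.
  - by rewrite phiE ler_pM2r ?subr_gt0//; nra.
have surjF := blowup_surj _ F' bnd.
apply: (@separable_ODE_integral _ _ (2 * (1 + k) * (1 + 1)) F _ F').
- move=> x xJ; have [p0 pK _] := bnd _ xJ.
  rewrite gtr0_norm// p0/=; apply: le_trans pK _.
  by rewrite ler_pM2l; [lra|lra].
- by apply: surjF; rewrite (@lt_trans _ _ 0)// invr_gt0.
Qed.

(** Between 1/k and 1 the field is negative and F decreases, so surjectivity is obtained for - F
    with the field - [slope_ODE k]. *)
Lemma slope_ODE_above (k : R) F I f (p : R -> R) : 1 < k ->
  (forall x, k^-1 < x < 1 -> is_derive x 1 F (slope_ODE k x)^-1) ->
  is_interval I -> (forall s, I s -> is_derive s 1 f (p s)) ->
  (forall s, I s -> is_derive s 1 p (slope_ODE k (p s))) ->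
  (forall s, I s -> k^-1 < p s < 1) ->
  exists s0 f0 : R, forall s, I s ->
    f s = integral_from0 (pinv [set x | k^-1 < x < 1] F) (s + s0) + f0.
Proof.
move=> k1 F'; have k0 : 0 < k by rewrite (lt_trans _ k1).
have vk1 : k^-1 < 1 by rewrite invf_lt1.
have vk0 : 0 < k^-1 by rewrite invr_gt0.
have phiE x : - slope_ODE k x = (1 - x ^+ 2) * k * (x - k^-1).
  by rewrite /slope_ODE; field; rewrite gt_eqF.
have bnd x : k^-1 < x < 1 -> [/\ 0 < - slope_ODE k x,
    - slope_ODE k x <= 2 * (1 + k) * (x - k^-1) &
    - slope_ODE k x <= 2 * (1 + k) * (1 - x)].
  move=> /andP[xk x1]; have kx : 1 < k * x.
    by rewrite -ltr_pdivrMl// mulr1.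
  split.
  - rewrite phiE !mulr_gt0 ?subr_gt0//; nra.
  - by rewrite phiE ler_pM2r ?subr_gt0//; nra.
  - rewrite /slope_ODE; suff : (1 + x) * (k * x - 1) <= 2 * (1 + k) by nra.
    nra.
have NF' x : k^-1 < x < 1 ->
    is_derive x 1 (fun t => - F t) (- slope_ODE k x)^-1.
  by move=> /F' D; rewrite invrN; exact: is_deriveN_fun.
have surjF y : exists2 x, k^-1 < x < 1 & F x = y.
  have [x xJ e] := blowup_surj vk1 NF' bnd (- y).
  by exists x => //; exact: oppr_inj.
apply: (@separable_ODE_integral _ _ (2 * (1 + k) * 1) F _ F') => //.
move=> x xJ; have [p0 _ pK] := bnd _ xJ.
rewrite -normrN gtr0_norm// p0/=; apply: le_trans pK _.
by rewrite ler_pM2l; [lra|lra].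
Qed.

Lemma slope_ODE_classification (m : nat) I f (p : R -> R) : (1 <= m)%N ->
  is_interval I -> (forall s, I s -> is_derive s 1 f (p s)) ->
  (forall s, I s -> is_derive s 1 p (slope_ODE m%:R (p s))) ->
  (forall s, I s -> -1 < p s < 1) ->
  [\/ exists f0 : R, forall s, I s -> f s = f1 m f0 s,
      m = 1%N /\
        exists s0 f0 : R, forall s, I s -> f s = f3 f0 (s + s0),
      (1 < m)%N /\
        exists s0 f0 : R, forall s, I s -> f s = f6 m f0 (s + s0) |
      (1 < m)%N /\
        exists s0 f0 : R, forall s, I s -> f s = f7 m f0 (s + s0)].
Proof.
move=> m1 itvI f' p' p1.
have k1 : 1 <= m%:R :> R by rewrite ler1n.
have k0 : 0 < m%:R :> R by rewrite ltr0n.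
have [[s1 Is1]|I0] := pselect (exists s, I s); last first.
  (* On an empty interval the affine alternative holds vacuously, whatever m is. *)
  by apply: Or41; exists 0 => s Is; exfalso; apply: I0; exists s.
have [[s2 [Is2 ps2]]|pk] := pselect (exists s, I s /\ p s = m%:R^-1).
  have pE := slope_equilibrium k0 itvI p' p1 Is2 ps2.
  apply: Or41; pose h s := f s + - ((0 : R) + m%:R^-1 * s).
  exists (h s1) => s Is; suff <- : h s = h s1 by rewrite /f1 /h; ring.
  apply: (is_derive_eq0_cst itvI _ Is Is1) => t It.
  have := is_deriveD_fun (f' _ It)
    (is_deriveN_fun (is_derive_affine m%:R^-1 0 t)).
  by rewrite pE// subrr.
have cp s (Is : I s) := is_derive_continuous (p' _ Is).
move: m1; rewrite leq_eqVlt => /predU1P[m1|m1].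
  (* For m = 1 the equilibrium 1/m is the right end of ]-1, 1[, so the lower component is the whole
     interval. *)
  subst m; apply: Or42; split=> //.
  have J1 (x : R) : (-1 < x < 1^-1) = (-1 < x < 1) by rewrite invr1.
  have dP2 (x : R) : -1 < x < 1^-1 -> is_derive x 1 (@P2 R) (slope_ODE 1 x)^-1.
    by rewrite J1; exact: is_derive_P2.
  have pJ s : I s -> -1 < p s < 1^-1 by rewrite J1; exact: p1.
  have [s0 [f0 fE]] := slope_ODE_below (lexx 1) dP2 itvI f' p' pJ.
  by exists s0, f0 => s Is; rewrite /f3 /P2_inv (fE s Is) invr1.
have k1' : 1 < m%:R :> R by rewrite ltr1n.
have vk1 : m%:R^-1 < 1 :> R by rewrite invf_lt1.
have vk0 : 0 < m%:R^-1 :> R by rewrite invr_gt0.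
(* p is continuous and avoids 1/m, so it stays on one side of it. *)
have side s t : I s -> I t -> p s < m%:R^-1 -> p t < m%:R^-1.
  move=> Is It ps; rewrite ltNge; apply/negP => pt; apply: pk.
  have [|c Ic pc] := @interval_IVT _ p s t m%:R^-1 itvI cp Is It.
    by rewrite ltW.
  by exists c.
have [ps1|ps1] := ltP (p s1) m%:R^-1.
  apply: Or43; split=> //; apply: (slope_ODE_below k1 _ itvI f' p').
    move=> x /andP[x0 xk]; apply: is_derive_Q => //.
      by rewrite x0 (lt_trans xk).
    by rewrite lt_eqF.
  by move=> s Is; rewrite (side s1)// andbT; case/andP: (p1 _ Is).
apply: Or44; split=> //; apply: (slope_ODE_above k1' _ itvI f' p').
  move=> x /andP[xk x1]; apply: is_derive_Q => //.
    by rewrite x1 andbT (lt_trans _ xk)// (lt_trans _ vk0)// oppr_lt0.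
  by rewrite gt_eqF.
move=> s Is; have /andP[_ ->] := p1 _ Is; rewrite andbT lt_neqAle.
apply/andP; split; first by apply/eqP => e; apply: pk; exists s.
by rewrite leNgt; apply/negP => /(side _ _ Is Is1); rewrite ltNge ps1.
Qed.

End RealLine.

(** * Functions constant on horospheres *)

Section Ray.
Context {R : realType} {V : normedModType R}.
Implicit Types (F : V -> R) (x v : V).

Lemma derive_line_cst F x v (c : R) :
  (forall h : R, F (h *: v + x) = c) -> 'D_v F x = 0.
Proof.
move=> Fc; have Fx : F x = c by rewrite -(Fc 0) scale0r add0r.
rewrite /derive.
have -> : (fun h : R => h^-1 *: ((F \o shift x) (h *: v) - F x)) = cst 0.
  by apply/funext => h; rewrite /= Fc Fx subrr scaler0.
by apply/cvg_lim => //; exact: cvg_cst.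
Qed.

(** The increment [h *: v] moves [r *: v] along the line spanned by v, so the two difference
    quotients coincide. *)
Lemma derive_ray F v (r : R) :
  'D_v F (r *: v) = derive1 (fun t => F (t *: v)) r.
Proof.
rewrite /derive.
have -> // : (fun h : R =>
      h^-1 *: ((F \o shift (r *: v)) (h *: v) - F (r *: v))) =
    (fun h : R => h^-1 *: (F ((h + r) *: v) - F (r *: v))).
by apply/funext => h /=; rewrite scalerDl.
Qed.

Lemma is_derive_ray F v (r : R) : derivable F (r *: v) v ->
  is_derive r 1 (fun t => F (t *: v)) ('D_v F (r *: v)).
Proof.
move=> dF; split; last by rewrite derive_ray derive1E.
suff e : (fun h : R => h^-1 *: ((F \o shift (r *: v)) (h *: v) - F (r *: v))) =
    (fun h : R => h^-1 *: (((fun t => F (t *: v)) \o shift r) (h *: 1)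
      - F (r *: v))).
  by move: dF; rewrite /derivable e.
by apply/funext => h /=; rewrite scalerDl [h *: 1]mulr1.
Qed.

End Ray.

(** * Gradient, norm and volume in the half-space model *)

Section Hyperbolic.
Context {R : realType} {m : nat}.
Implicit Types (u : 'rV[R]_m.+1 -> R) (x : 'rV[R]_m.+1).

Let e0 : 'rV[R]_m.+1 := delta_mx 0 ord0.

Lemma height_ray (t : R) : (t *: e0) 0 ord0 = t.
Proof. by rewrite !mxE eqxx mulr1. Qed.

Lemma height_shift x (h : R) (i : 'I_m.+1) : i != ord0 ->
  (h *: delta_mx 0 i + x) 0 ord0 = x 0 ord0.
Proof. by move=> i0; rewrite !mxE eq_sym (negPf i0) andbF mulr0 add0r. Qed.

Lemma hyp_gradE u x (i : 'I_m.+1) :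
  grad (@hyp_metric R m) u x 0 i = x 0 ord0 ^+ 2 * partial i u x.
Proof.
by rewrite /grad /hyp_metric invmx_scalar invrK mul_mx_scalar !mxE.
Qed.

Lemma hyp_gradZE (c : R) u x (i : 'I_m.+1) :
  (c *: grad (@hyp_metric R m) u x) 0 i = c * (x 0 ord0 ^+ 2 * partial i u x).
Proof. by rewrite mxE hyp_gradE. Qed.

(** The only nonzero gradient component is x_1^2 times the first partial derivative, and the metric
    divides its square by x_1^2. *)
Lemma hyp_normE u x : halfspace x ->
  (forall i : 'I_m.+1, i != ord0 -> partial i u x = 0) ->
  riem_norm (@hyp_metric R m) (grad (@hyp_metric R m) u) x
  = `|x 0 ord0 * partial ord0 u x|.
Proof.
rewrite /halfspace/= => x0 pu; rewrite /riem_norm -sqrtr_sqr; congr Num.sqrt.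
have := hyp_gradE u x; rewrite {2}/hyp_metric.
move: (grad _ u x) => X XE.
rewrite mul_mx_scalar -scalemxAl !mxE (bigD1 ord0)//= big1 ?addr0.
  by rewrite !mxE XE; field; rewrite gt_eqF.
by move=> i i0; rewrite mxE XE pu// !mulr0.
Qed.

Lemma hyp_weightE u x : halfspace x ->
  (forall i : 'I_m.+1, i != ord0 -> partial i u x = 0) ->
  graph_weight (-1) u x =
  Num.sqrt (1 - (x 0 ord0 * partial ord0 u x) ^+ 2).
Proof.
move=> x0 pu; rewrite /graph_weight hyp_normE// real_normK ?num_real//.
by rewrite mulN1r opprB.
Qed.

Lemma hyp_volE x : halfspace x ->
  Num.sqrt (\det (hyp_metric x)) = x 0 ord0 ^- m.+1.
Proof.
rewrite /halfspace/= => x0.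
rewrite /hyp_metric det_scalar -exprVn -exprM mulnC exprM.
by rewrite sqrtr_sqr -exprVn ger0_norm// exprn_ge0// invr_ge0 ltW.
Qed.

Lemma rho_ray (s : R) : rho (expR (- s) *: e0) = s.
Proof. by rewrite /rho height_ray expRK opprK. Qed.

End Hyperbolic.

(** * The translator equation along the ray of points [t *: e0], which meets every horosphere
    once *)

Section Foliated.
Context {R : realType} {m : nat}.
Variables (Omega : set 'rV[R]_m.+1) (u : 'rV[R]_m.+1 -> R).
Hypothesis Omega_open : open Omega.
Hypothesis Omega_sub : Omega `<=` @halfspace R m.
Hypothesis u_foliated : foliated_by_horospheres Omega u.

Let e0 : 'rV[R]_m.+1 := delta_mx 0 ord0.
(** The product [t * B t] is the derivative of u along the ray with respect to ln t, that is, to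
    hyperbolic arc length. *)
Let B (t : R) : R := partial ord0 u (t *: e0).

(** The horosphere through x meets Omega at x, hence lies in Omega; y belongs to it because
    [halfspace] and [rho] see only the height. *)
Lemma foliated_eq (x y : 'rV[R]_m.+1) : Omega x -> y 0 ord0 = x 0 ord0 ->
  Omega y /\ u y = u x.
Proof.
move=> Ox yx; have x0 := Omega_sub _ Ox.
have hx : horosphere (rho x) x by split.
have hy : horosphere (rho x) y by split; rewrite /halfspace/= /rho yx.
have [sub cst] := u_foliated _ (ex_intro _ x (conj hx Ox)).
by split; [exact: sub|exact: cst].
Qed.

Lemma foliated_partial (x : 'rV[R]_m.+1) (i : 'I_m.+1) : Omega x -> i != ord0 ->
  partial i u x = 0.
Proof.
move=> Ox i0; apply: (@derive_line_cst _ _ _ _ _ (u x)) => h.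
by have [] := foliated_eq _ _ Ox (height_shift x h i i0).
Qed.

Lemma near_ray (r : R) : Omega (r *: e0) ->
  \forall t \near r, Omega (t *: e0).
Proof.
move=> Or; have /= := @scalel_continuous R _ e0 r.
by apply; exact: open_nbhs_nbhs.
Qed.

Hypothesis u_C2 : C2_on Omega u.

Lemma is_derive_u_ray (r : R) : Omega (r *: e0) ->
  is_derive r 1 (fun t => u (t *: e0)) (B r).
Proof.
move=> Or; have [_ /(_ ord0 ord0)[du _ _ _]] := u_C2 _ Or.
exact: is_derive_ray.
Qed.

Lemma is_derive_B (r : R) : Omega (r *: e0) ->
  is_derive r 1 B (partial ord0 (partial ord0 u) (r *: e0)).
Proof.
move=> Or; have [_ /(_ ord0 ord0)[_ _ ddu _]] := u_C2 _ Or.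
exact: is_derive_ray.
Qed.

Hypothesis u_spacelike : spacelike Omega u.

Lemma ray_slope_lt1 (r : R) : Omega (r *: e0) -> `|r * B r| < 1.
Proof.
move=> Or; have := u_spacelike _ Or.
rewrite hyp_normE ?height_ray//; first exact: Omega_sub.
by move=> i; exact: foliated_partial.
Qed.

Hypothesis u_translator : translator (-1) Omega u.

(** With v = r B and W = sqrt (1 - v^2), the translator equation reads r^(m+1) (r^-m v / W)' = 1 /
    W. As v^2 + W^2 = 1, (v / W)' = v' / W^3, and multiplying by W^3 gives the claim. *)
Lemma ray_equation (r : R) : Omega (r *: e0) ->
  r * (B r + r * partial ord0 (partial ord0 u) (r *: e0)) =
  (1 - (r * B r) ^+ 2) * (1 + m%:R * (r * B r)).
Proof.
move=> Or.
have r0 : 0 < r by have := Omega_sub _ Or; rewrite /halfspace/= height_ray.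
pose v (t : R) : R := t * B t; pose W (t : R) : R := Num.sqrt (1 - v t ^+ 2).
pose dv : R := r * partial ord0 (partial ord0 u) (r *: e0) + B r * 1.
have Dv : is_derive r 1 v dv.
  exact: is_deriveM_fun (is_derive_id r 1) (is_derive_B _ Or).
have w0 : 0 < 1 - v r ^+ 2.
  have := ray_slope_lt1 _ Or; rewrite subr_gt0 -/(v r) => v1.
  by rewrite -real_normK ?num_real// expr_lt1.
have W0 : 0 < W r by rewrite sqrtr_gt0.
have W2 : W r ^+ 2 = 1 - v r ^+ 2 by rewrite sqr_sqrtr// ltW.
(* Volume density t^-(m+1) times the first component t^2 B / W of the normalized gradient. *)
pose g (t : R) : R := (t ^+ m)^-1 * (v t * (W t)^-1).
have DW : is_derive r 1 W ((2 * W r)^-1 * - (v r * dv + v r * dv)).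
  have -> : W = (fun t => Num.sqrt (1 + - (v t * v t))).
    by apply/funext => t; rewrite /W expr2.
  have := is_deriveD_fun (is_derive_cst (1 : R) r 1)
    (is_deriveN_fun (is_deriveM_fun Dv Dv)).
  rewrite add0r => D.
  have w0' : 0 < 1 + - (v r * v r) by rewrite -expr2.
  have := is_derive_comp_fun (g := fun t => 1 + - (v t * v t))
    (is_derive1_sqrt w0') D.
  exact.
have Wr0 : W r != 0 by rewrite gt_eqF.
have rm0 : r ^+ m != 0 by rewrite expf_neq0// gt_eqF.
have Dm : is_derive r 1 (fun t : R => t ^+ m) (m%:R * r ^+ m.-1).
  by split; [exact: exprn_derivable|rewrite exp_derive [_ *: 1]mulr1].
have Dg := is_deriveM_fun (@is_deriveV _ (fun t => t ^+ m) _ _ _ rm0 Dm)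
  (is_deriveM_fun Dv (@is_deriveV _ W _ _ _ Wr0 DW)).
have := u_translator _ Or.
rewrite /divergence hyp_volE; last exact: Omega_sub.
rewrite hyp_weightE; [|exact: Omega_sub|by move=> i; exact: foliated_partial].
rewrite height_ray -/(B r) -/(v r) -/(W r) (bigD1 ord0)//=.
(* The other components vanish along whole horospheres, hence so do their tangential derivatives. *)
rewrite [X in _ + X]big1 ?addr0; last first.
  move=> i i0; apply: (@derive_line_cst _ _ _ _ _ 0) => h.
  have [Oy _] := foliated_eq _ _ Or (height_shift (r *: e0) h i i0).
  by rewrite hyp_gradZE foliated_partial// !mulr0.
(* The derivative along [e0] sees only the ray, which near r lies in Omega, where the differentiated
   function is g. *)
rewrite [X in _ * X = _](_ : _ = 'D_1 g r); last first.
  rewrite [LHS]derive_ray derive1E; apply: near_eq_derive.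
  near=> t.
  have Ot : Omega (t *: e0) by near: t; exact: near_ray.
  have t0 : 0 < t by have := Omega_sub _ Ot; rewrite /halfspace/= height_ray.
  rewrite hyp_volE; last exact: Omega_sub.
  rewrite hyp_gradZE hyp_weightE; last 2 first.
  - exact: Omega_sub.
  - by move=> i; exact: foliated_partial.
  rewrite height_ray -/(B t) -/(v t) -/(W t) /g /v exprS invfM.
  by move: (W t)^-1 (t ^- m) => w q; field; rewrite gt_eqF.
rewrite (@derive_val _ _ _ _ _ _ _ Dg) /GRing.scale/=.
have -> : m%:R * r ^+ m.-1 = m%:R * r ^+ m / r.
  apply: (canRL (mulfK _)); first by rewrite gt_eqF.
  by case: (m) => [|k]; rewrite ?mul0r// -mulrA -exprSr.
have -> : B r + r * partial ord0 (partial ord0 u) (r *: e0) = dv.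
  by rewrite /dv mulr1 addrC.
rewrite exprS -W2.
have rn0 : r != 0 by rewrite gt_eqF.
clear g DW Dm Dg Dv w0; move: W2 Wr0 rm0; clearbody dv.
move: (v r) (W r) (r ^+ m) => a w P w2 wn0 P0 /(congr1 ( *%R (w ^+ 3))) eq.
have aw : a ^+ 2 + w ^+ 2 = 1 by rewrite w2 addrC subrK.
transitivity (r * dv * (a ^+ 2 + w ^+ 2)); first by rewrite aw mulr1.
transitivity (w ^+ 3 * w^-1 + m%:R * a * w ^+ 2); last by field.
rewrite -eq; field.
by rewrite rn0 P0 wn0.
Unshelve. all: by end_near. Qed.

(** * The profile as a function of s = [rho] *)

Let I : set R := [set s | Omega (expR (- s) *: e0)].
Let f (s : R) : R := u (expR (- s) *: e0).
(** Since s = - ln r, r d/dr becomes - d/ds: p is the derivative of f, and the factor 1 + m v of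
    [ray_equation] becomes 1 - m p. *)
Let p (s : R) : R := - (expR (- s) * B (expR (- s))).

Lemma is_derive_expRN (s : R) :
  is_derive s 1 (fun t : R => expR (- t)) (- expR (- s)).
Proof.
have idN := is_deriveN_fun (is_derive_id s (1 : R)).
have := is_derive_comp_fun (is_derive_expR (- s)) idN.
by rewrite mulrN1.
Qed.

Lemma is_derive_profile (s : R) : I s -> is_derive s 1 f (p s).
Proof.
move=> Is; have := is_derive_comp_fun (g := fun t => expR (- t))
  (is_derive_u_ray _ Is) (is_derive_expRN s).
by rewrite /p mulrN mulrC.
Qed.

Lemma is_derive_slope (s : R) : I s ->
  is_derive s 1 p (slope_ODE m%:R (p s)).
Proof.
move=> Is; pose b' := partial ord0 (partial ord0 u) (expR (- s) *: e0).
have D : is_derive (expR (- s)) 1 (fun t => t * B t)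
    (expR (- s) * b' + B (expR (- s)) * 1).
  exact: is_deriveM_fun (is_derive_id (expR (- s)) (1 : R)) (is_derive_B _ Is).
have := is_deriveN_fun (is_derive_comp_fun (g := fun t => expR (- t)) D
  (is_derive_expRN s)).
congr is_derive; rewrite mulrN opprK mulr1 mulrC addrC ray_equation//.
by rewrite /slope_ODE /p sqrrN mulrN opprK.
Qed.

Lemma profile_slope_lt1 (s : R) : I s -> -1 < p s < 1.
Proof. by move=> /ray_slope_lt1; rewrite -ltr_norml /p normrN. Qed.

Lemma near_profile (s : R) : I s -> \forall t \near s, I t.
Proof.
move=> Is; have ce := is_derive_continuous (is_derive_expRN s).
exact: (ce _ (near_ray _ Is)).
Qed.

(** As I is open, f' = p and f'' = [slope_ODE m%:R (p t)] hold near each point, so continuity of p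
    passes to f''. *)
Lemma profile_C2 : C2_itv I f.
Proof.
move=> s Is.
have f'p t : I t -> derive1 f t = p t.
  by move=> /is_derive_profile[_ <-]; rewrite derive1E.
have f''p t : I t -> derive1 (derive1 f) t = slope_ODE m%:R (p t).
  move=> It; rewrite derive1E; have [_ <-] := is_derive_slope _ It.
  by apply: near_eq_derive; apply: filterS (near_profile _ It) => r /f'p.
split.
- by have [] := is_derive_profile _ Is.
- have [+ _] := is_derive_slope _ Is; apply: near_eq_derivable.
  by apply: filterS (near_profile _ Is) => r /f'p.
- have cp := is_derive_continuous (is_derive_slope _ Is).
  rewrite /prop_for/continuous_at f''p//.
  have : slope_ODE m%:R (p t) @[t --> s] --> slope_ODE m%:R (p s).
    have c1 : cst (1 : R) t @[t --> s] --> (1 : R) by exact: cvg_cst.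
    apply: cvgM; first by apply: cvgB => //; exact: cvgM.
    by apply: cvgB => //; apply: cvgM => //; exact: cvg_cst.
  apply: cvg_trans; apply: near_eq_cvg.
  by apply: filterS (near_profile _ Is) => r /f''p.
Qed.

Lemma ray_rho (x : 'rV[R]_m.+1) :
  halfspace x -> (expR (- rho x) *: e0) 0 ord0 = x 0 ord0.
Proof. by move=> x0; rewrite height_ray /rho opprK lnK. Qed.

Lemma profileE (x : 'rV[R]_m.+1) : Omega x -> I (rho x) /\ u x = f (rho x).
Proof.
move=> Ox; have [Oy uy] := foliated_eq _ _ Ox (ray_rho _ (Omega_sub _ Ox)).
by split.
Qed.

Lemma foliated_preimage : Omega = [set x | halfspace x /\ I (rho x)].
Proof.
apply/seteqP; split=> [x Ox|x [hx Ix]].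
  by split; [exact: Omega_sub|have [] := profileE _ Ox].
by have [] := foliated_eq _ _ Ix (esym (ray_rho _ hx)).
Qed.

(** I is the image of the connected set Omega under [rho], which is continuous where x_1 > 0. *)
Lemma profile_interval : connected Omega -> is_interval I.
Proof.
move=> cO; apply/connected_intervalP.
have -> : I = @rho R m @` Omega.
  apply/seteqP; split=> [s Is|_ [x Ox <-]].
    by exists (expR (- s) *: e0) => //; exact: rho_ray.
  by have [] := profileE _ Ox.
apply: connected_continuous_connected => //.
apply: continuous_in_subspaceT => x; rewrite inE => /Omega_sub x0.
have cln := @continuous_comp _ _ _ (fun y : 'rV[R]_m.+1 => y 0 ord0) (@ln R) x
  (@coord_continuous R 1 m.+1 0 ord0 x) (continuous_ln x0).
have clnN := @continuous_comp _ _ _ (@ln R \o (fun y : 'rV[R]_m.+1 => y 0 ord0))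
  (-%R : R -> R) x cln (@opp_continuous R _).
exact: clnN.
Qed.

End Foliated.

(* The shift s0 is the integration constant of the separable equation for f';
   it corresponds to the isometry of hyperbolic space given by a dilation. *)
Theorem theorem3p1 (R : realType) (m : nat) (m_ge1 : (1 <= m)%N)
    (Omega : set 'rV[R]_m.+1) (u : 'rV[R]_m.+1 -> R)
    (Omega_open : open Omega) (Omega_connected : connected Omega)
    (Omega_sub : Omega `<=` @halfspace R m)
    (u_C2 : C2_on Omega u) (u_spacelike : spacelike Omega u)
    (u_translator : translator (-1) Omega u) :
  foliated_by_horospheres Omega u <->
  exists (I : set R) (f : R -> R),
    [/\ is_interval I,
        Omega = [set x | @halfspace R m x /\ I (rho x)],
        C2_itv I f,
        forall x, Omega x -> u x = f (rho x) &
        [\/ exists f0 : R, forall s, I s -> f s = f1 m f0 s,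
            m = 1%N /\
              exists s0 f0 : R, forall s, I s -> f s = f3 f0 (s + s0),
            (1 < m)%N /\
              exists s0 f0 : R, forall s, I s -> f s = f6 m f0 (s + s0) |
            (1 < m)%N /\
              exists s0 f0 : R, forall s, I s -> f s = f7 m f0 (s + s0)]].
Proof.
split=> [fol|[I [f [_ OE _ uf _]]] c [x [[_ xc] Ox]]].
  pose ray (s : R) := expR (- s) *: (delta_mx 0 ord0 : 'rV[R]_m.+1).
  have itv := profile_interval _ _ Omega_sub fol Omega_connected.
  have cls := slope_ODE_classification m_ge1 itv
      (is_derive_profile _ _ u_C2)
      (is_derive_slope _ _ Omega_open Omega_sub fol u_C2 u_spacelike
        u_translator)
      (profile_slope_lt1 _ _ Omega_sub fol u_spacelike).
  exists [set s | Omega (ray s)], (fun s => u (ray s)); split=> //.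
  - exact: foliated_preimage fol.
  - exact: profile_C2.
  - by move=> x Ox; have [] := profileE _ _ Omega_sub fol _ Ox.
(* Conversely, both membership in Omega and the value of u there depend on a point of the half-space
   through [rho] alone. *)
have Ic : I c by move: Ox; rewrite OE -xc => -[].
have sub : horosphere c `<=` Omega.
  by move=> y [hy yc]; rewrite OE; split=> //; rewrite yc.
split=> // y z hy hz; rewrite !uf; [|exact: sub|exact: sub].
by case: hy hz => _ -> [_ ->].
Qed.
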